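(* For a metric space $\mathcal P$ and a quasi-Banach function lattice $X$ (as in the context) consider the properties (A)–(G) defined in the context. Then, for all such $\mathcal P$ and $X$: (i) $\big((D)\text{ and }(G)\big)\iff\big((E)\text{ and }(F)\big)\iff(A)$; (ii) $(A)\Rightarrow(B)\Rightarrow(C)\Rightarrow(D)\Rightarrow(E)$, $(A)\Rightarrow(F)$ and $(F)\Rightarrow(G)$. Moreover, none of the following implications holds in general; for each of them there exist a metric space $\mathcal P$ satisfying the standing assumptions and a (normed) Banach function lattice $X$ for which it fails: $(B)\Rightarrow(A)$, $(C)\Rightarrow(B)$, $(D)\Rightarrow(C)$, $(B)\Rightarrow(G)$, $(G)\Rightarrow(F)$, $(F)\Rightarrow(E)$. Finally, there exist $\mathcal P$ and $X$ for which all of (A)–(G) fail.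
   Context: Standing assumptions: $\mathcal P=(\mathcal P,d,\mu)$ is a metric space with a positive complete Borel measure $\mu$ such that $0<\mu(B)<\infty$ for every ball $B$; $\mu$ is extended as an outer measure to all subsets. $\overline{\mathbf R}=[-\infty,\infty]$. A quasi-Banach function lattice $X=X(\mathcal P)$ is a vector space of extended real-valued measurable functions defined everywhere on $\mathcal P$ with a functional $\|\cdot\|_X$ such that: $X=\{u:\|u\|_X<\infty\}$; $\|u\|_X=0$ iff $u=0$ a.e., $\|au\|_X=|a|\|u\|_X$, and $\|u+v\|_X\le c_\wedge(\|u\|_X+\|v\|_X)$ for some constant $c_\wedge\ge1$; $|u|\le|v|$ a.e. implies $\|u\|_X\le\|v\|_X$; and if $u_n\ge0$ a.e. then $\|\sum_{n\ge1}u_n\|_X\le\sum_{n\ge1}c_\wedge^n\|u_n\|_X$. The quasinorm is assumed continuous: $\|u_n-u\|_X\to0$ implies $\|u_n\|_X\to\|u\|_X$. If $c_\wedge=1$, $X$ is called a Banach function lattice. Curves are continuous maps from compact intervals; rectifiable curves are parametrized by arc length. A Borel $g:\mathcal P\to[0,\infty]$ is an upper gradient of $u:\mathcal P\to\overline{\mathbf R}$ if $|u(\gamma(0))-u(\gamma(l_\gamma))|\le\int_\gamma g\,ds$ for every nonconstant rectifiable curve $\gamma:[0,l_\gamma]\to\mathcal P$ (with $|(\pm\infty)-(\pm\infty)|=\infty$). $N^1X(\mathcal P)=\{u\in X:\|u\|_{N^1X}:=\|u\|_X+\inf_g\|g\|_X<\infty\}$, infimum over upper gradients of $u$. Capacity: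 $C_X(E)=\inf\{\|u\|_{N^1X}:u\in N^1X,\ u\ge1\text{ on }E\}$; ''q.e.'' means outside a set of zero capacity. $C_X$ is a $c$-quasiouter capacity ($c\ge1$) if $\inf\{C_X(G):G\supset E\text{ open}\}\le cC_X(E)$ for all $E\subset\mathcal P$; quasiouter if this holds for some $c$; outer if it holds with $c=1$; outer for sets of zero capacity if whenever $C_X(E)=0$ and $\varepsilon>0$ there is an open $G\supset E$ with $C_X(G)<\varepsilon$. A function $u:\mathcal P\to\overline{\mathbf R}$ is weakly quasicontinuous if for every $\varepsilon>0$ there is $E$ with $C_X(E)<\varepsilon$ and $u|_{\mathcal P\setminus E}$ (real-valued) continuous; quasicontinuous if $E$ can in addition be chosen open. Properties: (A) every $u\in N^1X(\mathcal P)$ is quasicontinuous; (B) $C_X$ is an outer capacity; (C) $C_X$ is a quasiouter capacity; (D) every weakly quasicontinuous $u:\mathcal P\to\overline{\mathbf R}$ is quasicontinuous; (E) $C_X$ is an outer capacity for sets of zero capacity; (F) every $u\in N^1X(\mathcal P)$ has a quasicontinuous $v$ with $v=u$ q.e.; (G) every $u\in N^1X(\mathcal P)$ is weakly quasicontinuous. *)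

(* Defs.v *)
From HB Require Import structures.
From mathcomp Require Import all_boot all_order all_algebra.
From mathcomp Require Import all_classical all_reals all_analysis.
From mathcomp Require Import Rstruct Rstruct_topology.

Set Implicit Arguments.
Unset Strict Implicit.
Unset Printing Implicit Defensive.

Import Order.TTheory GRing.Theory Num.Theory.
Import numFieldNormedType.Exports.

Local Open Scope classical_set_scope.
Local Open Scope ring_scope.

Notation RR := Rdefinitions.R.

Definition is_open_d (T : Type) (d : T -> T -> RR) (G : set T) : Prop :=
  forall x, G x -> exists r : RR, 0 < r /\ forall y, d x y < r -> G y.

Definition ball_d (T : Type) (d : T -> T -> RR) (x : T) (r : RR) : set T :=
  [set y | d x y < r].

Record mms (T : Type) := MMS {
  dist : T -> T -> RR;
  mmeas : set (set T);
  mu : set T -> \bar RR;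
  dist_ge0 : forall x y, 0 <= dist x y;
  dist_eq0 : forall x y, dist x y = 0 <-> x = y;
  dist_sym : forall x y, dist x y = dist y x;
  dist_tri : forall x y z, dist x z <= dist x y + dist y z;
  mmeas_sigma : sigma_algebra setT mmeas;
  mmeas_borel : <<s is_open_d dist >> `<=` mmeas;
  mu0 : mu set0 = 0%E;
  mu_ge0 : forall A, mmeas A -> (0 <= mu A)%E;
  mu_sigma_additive : forall F : nat -> set T,
    (forall n, mmeas (F n)) -> trivIset setT F ->
    (fun n => (\sum_(i < n) mu (F i))%E) @ \oo --> mu (\bigcup_n F n);
  mu_complete : forall A N, mmeas N -> mu N = 0%E -> A `<=` N -> mmeas A;
  mu_ball : forall x (r : RR), 0 < r ->
    (0 < mu (ball_d dist x r))%E /\ (mu (ball_d dist x r) < +oo)%E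
}.

Section MMSDefs.
Context (T : Type) (S : mms T).
Local Notation d := (dist S).

Definition is_open (G : set T) : Prop := is_open_d d G.

Definition is_borel (A : set T) : Prop := <<s is_open_d d >> A.

Definition mu_out (E : set T) : \bar RR :=
  ereal_inf [set mu S A | A in [set A | mmeas S A /\ E `<=` A]].

Definition ae (P : T -> Prop) : Prop := mu_out [set x | ~ P x] = 0%E.

Definition meas_fun (u : T -> \bar RR) : Prop :=
  forall a : RR, mmeas S [set x | (a%:E < u x)%E].

Definition borel_fun (u : T -> \bar RR) : Prop :=
  forall a : RR, is_borel [set x | (a%:E < u x)%E].

Definition curve_length (gamma : RR -> T) (s t : RR) : \bar RR :=
  ereal_sup [set z | exists (n : nat) (p : nat -> RR),
     p 0%N = s /\ p n = t /\ (forall i, (i < n)%N -> p i <= p i.+1) /\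
     z = (\sum_(i < n) d (gamma (p i)) (gamma (p i.+1)))%:E].

(* gamma : [0,l] -> P is a curve parametrized by arc length
   (such a gamma is automatically 1-Lipschitz, hence continuous, and rectifiable) *)
Definition arclength_param (gamma : RR -> T) (l : RR) : Prop :=
  forall s t, 0 <= s -> s <= t -> t <= l ->
    curve_length gamma s t = (t - s)%:E.

Definition absdiff (a b : \bar RR) : \bar RR :=
  match a, b with
  | EFin r, EFin s => (`|r - s|)%:E
  | _, _ => +oo%E
  end.

Definition line_integral (g : T -> \bar RR) (gamma : RR -> T) (l : RR) : \bar RR :=
  let I : set RR := `[0, l]%classic in
  (\int[@lebesgue_measure RR]_(t in I) g (gamma t))%E.

(* g is an upper gradient of u; nonconstant rectifiable curves are exactly
   arc-length parametrized curves gamma : [0,l] -> P with l > 0 *)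
Definition upper_gradient (u g : T -> \bar RR) : Prop :=
  (forall x, (0 <= g x)%E) /\ borel_fun g /\
  forall (gamma : RR -> T) (l : RR), 0 < l -> arclength_param gamma l ->
    (absdiff (u (gamma 0%R)) (u (gamma l)) <= line_integral g gamma l)%E.

Definition cont_off (u : T -> \bar RR) (E : set T) : Prop :=
  (forall x, ~ E x -> u x \is a fin_num) /\
  forall x, ~ E x -> forall eps : RR, 0 < eps -> exists delta : RR, 0 < delta /\
    forall y, ~ E y -> d x y < delta -> `|fine (u y) - fine (u x)| < eps.

End MMSDefs.

Record qbfl (T : Type) (S : mms T) := QBFL {
  qnorm : (T -> \bar RR) -> \bar RR;
  cwedge : RR;
  cwedge_ge1 : 1 <= cwedge;
  qnorm_ge0 : forall u, meas_fun S u -> (0 <= qnorm u)%E;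
  qnorm_eq0 : forall u, meas_fun S u -> (qnorm u = 0%E <-> ae S (fun x => u x = 0%E));
  qnorm_hom : forall (a : RR) u, meas_fun S u ->
    qnorm (fun x => (a%:E * u x)%E) = (`|a|%:E * qnorm u)%E;
  qnorm_quasi_tri : forall u v, meas_fun S u -> meas_fun S v ->
    (qnorm (fun x => u x + v x) <= cwedge%:E * (qnorm u + qnorm v))%E;
  qnorm_lattice : forall u v, meas_fun S u -> meas_fun S v ->
    ae S (fun x => (`|u x| <= `|v x|)%E) -> (qnorm u <= qnorm v)%E;
  qnorm_series : forall un : nat -> T -> \bar RR,
    (forall n, meas_fun S (un n)) -> (forall n, ae S (fun x => (0 <= un n x)%E)) ->
    (qnorm (fun x => \sum_(0 <= n <oo) un n x) <=
       \sum_(0 <= n <oo) ((cwedge ^+ n.+1)%:E * qnorm (un n)))%E;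
  qnorm_cont : forall (un : nat -> T -> \bar RR) (u : T -> \bar RR),
    meas_fun S u -> (qnorm u < +oo)%E ->
    (forall n, meas_fun S (un n) /\ (qnorm (un n) < +oo)%E) ->
    (fun n => qnorm (fun x => un n x - u x)%E) @ \oo --> 0%E ->
    (fun n => qnorm (un n)) @ \oo --> qnorm u
}.

Section Newtonian.
Context (T : Type) (S : mms T) (X : qbfl S).
Local Notation nX := (qnorm X).

Definition in_X (u : T -> \bar RR) : Prop := meas_fun S u /\ (nX u < +oo)%E.

Definition banach : Prop := cwedge X = 1.

Definition N1norm (u : T -> \bar RR) : \bar RR :=
  (nX u + ereal_inf [set nX g | g in [set g | upper_gradient S u g]])%E.

Definition in_N1X (u : T -> \bar RR) : Prop := in_X u /\ (N1norm u < +oo)%E.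

Definition capX (E : set T) : \bar RR :=
  ereal_inf [set N1norm u | u in [set u | in_N1X u /\ forall x, E x -> (1 <= u x)%E]].

Definition qe_eq (u v : T -> \bar RR) : Prop :=
  exists N : set T, capX N = 0%E /\ forall x, ~ N x -> u x = v x.

Definition weakly_quasicontinuous (u : T -> \bar RR) : Prop :=
  forall eps : RR, 0 < eps -> exists E : set T, (capX E < eps%:E)%E /\ cont_off S u E.

Definition quasicontinuous (u : T -> \bar RR) : Prop :=
  forall eps : RR, 0 < eps -> exists E : set T,
    is_open S E /\ (capX E < eps%:E)%E /\ cont_off S u E.

Definition outer_inf (E : set T) : \bar RR :=
  ereal_inf [set capX G | G in [set G | is_open S G /\ E `<=` G]].

Definition propA : Prop := forall u, in_N1X u -> quasicontinuous u.
Definition propB : Prop := forall E : set T, (outer_inf E <= capX E)%E.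
Definition propC : Prop :=
  exists c : RR, 1 <= c /\ forall E : set T, (outer_inf E <= c%:E * capX E)%E.
Definition propD : Prop :=
  forall u : T -> \bar RR, weakly_quasicontinuous u -> quasicontinuous u.
Definition propE : Prop :=
  forall E : set T, capX E = 0%E -> forall eps : RR, 0 < eps ->
    exists G : set T, is_open S G /\ E `<=` G /\ (capX G < eps%:E)%E.
Definition propF : Prop :=
  forall u, in_N1X u -> exists v, quasicontinuous v /\ qe_eq v u.
Definition propG : Prop := forall u, in_N1X u -> weakly_quasicontinuous u.

End Newtonian.

(* Main.v *)
(* A nonnegative function admissible for the capacity of E and continuous off a small
   open set V yields, by slightly enlarging it and taking the maximum with a function
   admissible for V, a function admissible for an open neighbourhood of E; continuity
   of the quasinorm then gives (A) => (B). A function that is infinite exactly on a set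
   of zero capacity gives (D) => (E), and the remaining implications follow from
   quasi-subadditivity of the capacity.

   For the counterexamples, let P be the disjoint union of countably many convergent
   sequences with their limits (k, 0), and X a weighted sup-norm space with weight w.
   There are no nonconstant rectifiable curves because P is countable, so 0 is an upper
   gradient of everything and the capacity of E is the supremum of w over E. Weights
   w(k, 0) at the limits and w(k, n) at the isolated points:
     (B) without (A), (G) :  1 and 1;          (C) without (B) :  1 and 2;
     (D) without (C) :  1/(k+1) and 1;         (G) without (F) :  0 and 1;
     (F) without (E) :  0 and n;               none of (A)-(G) :  w(0, 0) = 0, else 1.
   Points of weight 0 also carry no mass, so they are null for the lattice. *)
From HB Require Import structures.
From mathcomp Require Import all_boot all_order all_algebra.
From mathcomp Require Import all_classical all_reals all_analysis.
From mathcomp Require Import measurable_realfun Rstruct Rstruct_topology ring lra.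
Require Import Defs.

Set Implicit Arguments.
Unset Strict Implicit.
Unset Printing Implicit Defensive.

Import Order.TTheory GRing.Theory Num.Theory.
Import numFieldNormedType.Exports.

Local Open Scope classical_set_scope.
Local Open Scope ring_scope.

(** * Functions measurable with respect to a bare sigma-algebra *)

Section SigmaAlgebraFunctions.
Context (R : realType).

(** Unfolds to [meas_fun] when [M] consists of the measurable sets and to [borel_fun] when it
    consists of the Borel sets, so closure properties are proved once for both. *)
Definition ray_fun (T : Type) (M : set (set T)) (u : T -> \bar R) :=
  forall a : R, M [set x | (a%:E < u x)%E].

(** The rays generate the Borel sets of the extended line, and a sigma-algebra generates itself;
    this gives access to the library of measurable functions. *)
Lemma ray_fun_measurable (T : pointedType) (M : set (set T)) (u : T -> \bar R) :
  sigma_algebra setT M ->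
  ray_fun M u <-> measurable_fun [set: g_sigma_algebraType M]
    (u : g_sigma_algebraType M -> \bar R).
Proof.
move=> sM; split => [uM|mu a]; last first.
  have := emeasurable_fun_o_infty (@measurableT _ (g_sigma_algebraType M)) mu a%:E.
  by rewrite setTI /measurable/= sigma_algebra_id.
apply: (measurability _ (ErealGenOInfty.measurableE R)).
move=> /= _ [_ [a ->]] <-; apply: measurableI => //.
by rewrite preimage_itvoy /measurable/= sigma_algebra_id//; exact: uM.
Qed.

Lemma ray_funB (T : Type) (M : set (set T)) (u v : T -> \bar R) :
  sigma_algebra setT M -> ray_fun M u -> ray_fun M v ->
  ray_fun M (fun x => u x - v x)%E.
Proof.
(* Measurable types are pointed; on an empty [T] the only set is [set0], which belongs to [M]. *)
elim/Ppointed: T => T in M u v *.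
  by move=> [M0 _ _] _ _ a; rewrite emptyE in M0 *.
move=> sM /(ray_fun_measurable _ sM) mu /(ray_fun_measurable _ sM) mv.
by apply/(ray_fun_measurable _ sM); exact: emeasurable_funB.
Qed.

Lemma ray_funD (T : Type) (M : set (set T)) (u v : T -> \bar R) :
  sigma_algebra setT M -> ray_fun M u -> ray_fun M v ->
  ray_fun M (fun x => u x + v x)%E.
Proof.
elim/Ppointed: T => T in M u v *.
  by move=> [M0 _ _] _ _ a; rewrite emptyE in M0 *.
move=> sM /(ray_fun_measurable _ sM) mu /(ray_fun_measurable _ sM) mv.
by apply/(ray_fun_measurable _ sM); exact: emeasurable_funD.
Qed.

Lemma ray_fun_max (T : Type) (M : set (set T)) (u v : T -> \bar R) :
  sigma_algebra setT M -> ray_fun M u -> ray_fun M v ->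
  ray_fun M (fun x => maxe (u x) (v x)).
Proof.
elim/Ppointed: T => T in M u v *.
  by move=> [M0 _ _] _ _ a; rewrite emptyE in M0 *.
move=> sM /(ray_fun_measurable _ sM) mu /(ray_fun_measurable _ sM) mv.
by apply/(ray_fun_measurable _ sM); exact: measurable_maxe.
Qed.

Lemma ray_funZ (T : Type) (M : set (set T)) (k : R) (u : T -> \bar R) :
  sigma_algebra setT M -> ray_fun M u -> ray_fun M (fun x => k%:E * u x)%E.
Proof.
elim/Ppointed: T => T in M u *.
  by move=> [M0 _ _] _ a; rewrite emptyE in M0 *.
move=> sM /(ray_fun_measurable _ sM) mu.
by apply/(ray_fun_measurable _ sM); exact: measurable_funeM.
Qed.

Lemma ray_fun_cst (T : Type) (M : set (set T)) (k : \bar R) :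
  sigma_algebra setT M -> ray_fun M (fun=> k).
Proof.
elim/Ppointed: T => T in M *.
  by move=> [M0 _ _] a; rewrite emptyE in M0 *.
by move=> sM; apply/(ray_fun_measurable _ sM); exact: measurable_cst.
Qed.

End SigmaAlgebraFunctions.

(** * Upper gradients under maxima and positive scaling *)

Section UpperGradients.
Context (T : Type) (S : mms T).
Implicit Types (u v g h : T -> \bar RR).

Lemma meas_fun_max u v : meas_fun S u -> meas_fun S v ->
  meas_fun S (fun x => maxe (u x) (v x)).
Proof. exact: ray_fun_max (mmeas_sigma S). Qed.

Lemma meas_funB u v : meas_fun S u -> meas_fun S v ->
  meas_fun S (fun x => u x - v x)%E.
Proof. exact: ray_funB (mmeas_sigma S). Qed.

Lemma meas_funD u v : meas_fun S u -> meas_fun S v ->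
  meas_fun S (fun x => u x + v x)%E.
Proof. exact: ray_funD (mmeas_sigma S). Qed.

Lemma meas_funZ k u : meas_fun S u -> meas_fun S (fun x => k%:E * u x)%E.
Proof. exact: ray_funZ (mmeas_sigma S). Qed.

Lemma meas_fun_cst k : meas_fun S (fun=> k).
Proof. exact: ray_fun_cst (mmeas_sigma S). Qed.

Lemma meas_fun_borel g : borel_fun S g -> meas_fun S g.
Proof. by move=> bg a; apply: mmeas_borel; exact: bg. Qed.

Lemma aeT (P : T -> Prop) : (forall x, P x) -> ae S P.
Proof.
move=> hP; rewrite /ae /mu_out.
have -> : [set x | ~ P x] = set0 by apply/seteqP; split => x //=; apply; exact: hP.
have [M0 _ _] := mmeas_sigma S.
apply/eqP; rewrite eq_le; apply/andP; split.
  by apply: ereal_inf_lbound; exists set0; [split|exact: mu0].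
by apply: le_ereal_inf_tmp => _ [A [mA _] <-]; exact: mu_ge0.
Qed.

(* The integral of a nonnegative function is a supremum over simple functions. *)
Lemma le_line_integral g h (gamma : RR -> T) (l : RR) :
  (forall x, 0 <= g x)%E -> (forall x, g x <= h x)%E ->
  (line_integral g gamma l <= line_integral h gamma l)%E.
Proof.
move=> g0 gh; have h0 x : (0 <= h x)%E by apply: le_trans (gh x).
rewrite /line_integral !ge0_integralE//.
apply: ereal_sup_le => _ [f /= fg <-]; exists f => //= x.
by apply: (le_trans (fg x)); rewrite /patch; case: ifP.
Qed.

Import HBNNSimple.

(** Multiplying by [k] a simple function below [g] along the curve gives one below [k] times [g], so
    the suprema defining the integrals compare. *)
Lemma line_integralZ g (k : RR) (gamma : RR -> T) (l : RR) :
  0 < k -> (forall x, 0 <= g x)%E ->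
  (k%:E * line_integral g gamma l <=
   line_integral (fun x => k%:E * g x) gamma l)%E.
Proof.
move=> k0 g0; rewrite -lee_pdivlMl//.
rewrite /line_integral ge0_integralE// ge0_integralE//; last first.
  by move=> x _; rewrite mule_ge0// lee_fin ltW.
apply: ge_ereal_sup => _ [f /= fg <-]; rewrite lee_pdivlMl//.
have -> : (k%:E * sintegral lebesgue_measure f =
    sintegral lebesgue_measure (scale_nnsfun f (ltW k0)))%E.
  by rewrite -sintegralrM.
apply: ereal_sup_ubound; exists (scale_nnsfun f (ltW k0)) => //= x.
have := fg x; rewrite /patch; case: ifP => _ fx.
  by rewrite EFinM lee_pmul2l.
by rewrite EFinM -[leRHS](mule0 k%:E) lee_pmul2l.
Qed.

(** One infinite argument makes the right side [+oo]; between reals, the maximum is 1-Lipschitz for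
    the sup norm. *)
Lemma absdiff_max (a b c d : \bar RR) :
  (absdiff (maxe a c) (maxe b d) <= maxe (absdiff a b) (absdiff c d))%E.
Proof.
have [ab|ab] := boolP ((a \is a fin_num) && (b \is a fin_num)); last first.
  apply: (@le_trans _ _ +oo%E); first exact: leey.
  by rewrite le_max; apply/orP; left; case: a b ab => [?||] [?||].
have [cd|cd] := boolP ((c \is a fin_num) && (d \is a fin_num)); last first.
  apply: (@le_trans _ _ +oo%E); first exact: leey.
  by rewrite le_max; apply/orP; right; case: c d cd => [?||] [?||].
case: a b c d ab cd => [a||] [b||]// [c||] [d||]// _ _.
rewrite -!EFin_max /= lee_fin.
set m := Num.max `|a - b| `|c - d|.
have : `|a - b| <= m by rewrite le_max lexx.
have : `|c - d| <= m by rewrite le_max lexx orbT.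
move: m => m; rewrite !ler_norml => /andP[? ?] /andP[? ?].
by case: (leP a c) => ?; case: (leP b d) => ?; apply/andP; split; lra.
Qed.

Lemma absdiffZ (k : RR) (a b : \bar RR) : 0 < k ->
  absdiff (k%:E * a)%E (k%:E * b)%E = (k%:E * absdiff a b)%E.
Proof.
move=> k0; case: a b => [a||] [b||]/=; rewrite ?(gt0_muley, gt0_muleNy)//.
by rewrite -mulrBr normrM gtr0_norm.
Qed.

Lemma absdiff_self (a : RR) : absdiff a%:E a%:E = 0%E.
Proof. by rewrite /= subrr normr0. Qed.

Lemma upper_gradient_max u v g h : upper_gradient S u g -> upper_gradient S v h ->
  upper_gradient S (fun x => maxe (u x) (v x)) (fun x => maxe (g x) (h x)).
Proof.
move=> [g0 [bg ug]] [h0 [bh vh]]; split=> [x|]; first by rewrite le_max g0.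
split; first by apply: ray_fun_max => //; exact: smallest_sigma_algebra.
move=> gam l l0 al; apply: (le_trans (absdiff_max _ _ _ _)).
rewrite ge_max; apply/andP; split.
  apply: (le_trans (ug gam l l0 al)); apply: le_line_integral => // x.
  by rewrite le_max lexx.
apply: (le_trans (vh gam l l0 al)); apply: le_line_integral => // x.
by rewrite le_max lexx orbT.
Qed.

Lemma upper_gradientZ u g (k : RR) : 0 < k -> upper_gradient S u g ->
  upper_gradient S (fun x => k%:E * u x)%E (fun x => k%:E * g x)%E.
Proof.
move=> k0 [g0 [bg ug]]; split=> [x|]; first by rewrite mule_ge0// lee_fin ltW.
split; first by apply: ray_funZ => //; exact: smallest_sigma_algebra.
move=> gam l l0 al; rewrite absdiffZ//.
apply: le_trans (line_integralZ gam l k0 g0).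
by rewrite lee_pmul2l//; exact: ug.
Qed.

Lemma borel_fun_cst k : borel_fun S (fun=> k).
Proof. exact: ray_fun_cst (smallest_sigma_algebra _ _). Qed.

Lemma upper_gradient_cst (k : RR) : upper_gradient S (fun=> k%:E) (fun=> 0%E).
Proof.
split=> //; split; first exact: borel_fun_cst.
by move=> gam l l0 _; rewrite absdiff_self; exact: integral_ge0.
Qed.

(** This is the maximum with the constant 0, whose upper gradient 0 does not change [g]. It makes
    admissible functions nonnegative at no cost. *)
Lemma upper_gradient_pos u g : upper_gradient S u g ->
  upper_gradient S (fun x => maxe (u x) 0%E) g.
Proof.
move=> ug; have := upper_gradient_max ug (upper_gradient_cst 0).
congr upper_gradient; apply: funext => x.
by apply/max_idPl; case: ug.
Qed.

End UpperGradients.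

(** * Capacity estimates and the implications valid in every lattice *)

Section Capacity.
Context (T : Type) (S : mms T) (X : qbfl S).
Implicit Types (u v g h : T -> \bar RR) (E F G V : set T).
Local Notation nX := (qnorm X).
Local Notation c := (cwedge X).

Lemma cwedge_gt0 : 0 < c.
Proof. exact: lt_le_trans ltr01 (cwedge_ge1 X). Qed.

Lemma qnorm_cst0 : nX (fun=> 0%E) = 0%E.
Proof. by apply/qnorm_eq0; [exact: meas_fun_cst|exact: aeT]. Qed.

Lemma le_qnorm u v : meas_fun S u -> meas_fun S v ->
  (forall x, `|u x| <= `|v x|)%E -> (nX u <= nX v)%E.
Proof. by move=> mu mv uv; apply: qnorm_lattice => //; exact: aeT. Qed.

Lemma upper_gradient_meas u g : upper_gradient S u g -> meas_fun S g.
Proof. by move=> [_ [bg _]]; exact: meas_fun_borel. Qed.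

Lemma N1norm_ge0 u : meas_fun S u -> (0 <= N1norm X u)%E.
Proof.
move=> mu; apply: adde_ge0; first exact: qnorm_ge0.
apply: le_ereal_inf_tmp => _ [g ug <-]; apply: qnorm_ge0.
exact: upper_gradient_meas ug.
Qed.

Lemma N1norm_le u g : upper_gradient S u g -> (N1norm X u <= nX u + nX g)%E.
Proof. by move=> ug; apply: leeD2l; apply: ereal_inf_lbound; exists g. Qed.

Lemma capX_ge0 E : (0 <= capX X E)%E.
Proof. by apply: le_ereal_inf_tmp => _ [u [[[mu _] _] _] <-]; exact: N1norm_ge0. Qed.

(** If the right side is finite, then [u] lies in the Newtonian space and is admissible; otherwise
    there is nothing to prove. *)
Lemma capX_le E u g : meas_fun S u -> upper_gradient S u g ->
  (forall x, E x -> 1 <= u x)%E -> (capX X E <= nX u + nX g)%E.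
Proof.
move=> mu ug uE; have [->|fin] := eqVneq (nX u + nX g)%E +oo%E; first exact: leey.
have {}fin : (nX u + nX g < +oo)%E by rewrite ltey.
apply: le_trans (N1norm_le ug); apply: ereal_inf_lbound; exists u => //.
split=> //; split; last exact: le_lt_trans (N1norm_le ug) fin.
split=> //; apply: le_lt_trans fin.
by rewrite leeDl// qnorm_ge0//; exact: upper_gradient_meas ug.
Qed.

(** Unpacks both infima at once. Truncation at 0 gives the nonnegativity, and the strict inequality
    leaves room to select a single upper gradient. *)
Lemma capX_lt E (e : RR) : (capX X E < e%:E)%E ->
  exists u g (a b : RR), [/\ meas_fun S u /\ upper_gradient S u g,
    (forall x, 0 <= u x)%E, (forall x, E x -> 1 <= u x)%E,
    nX u = a%:E /\ nX g = b%:E & [/\ 0 <= a, 0 <= b & a + b < e]].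
Proof.
move=> /ereal_inf_lt[_ [u [[[mu fu] _] uE] <-]].
have u0 := qnorm_ge0 X mu.
have finu : nX u \is a fin_num by rewrite ge0_fin_numE.
rewrite /N1norm -lteBrDl// => /ereal_inf_lt[_ [g ug <-]].
have mg := upper_gradient_meas ug; have g0 := qnorm_ge0 X mg.
rewrite lteBrDl// => lte; pose p x := maxe (u x) 0%E.
have mp : meas_fun S p by apply: meas_fun_max => //; exact: meas_fun_cst.
have pu : (nX p <= nX u)%E.
  apply: le_qnorm => // x; rewrite /p.
  by case: (leP (u x) 0%E) => // _; rewrite abse0.
have fing : nX g \is a fin_num.
  by rewrite ge0_fin_numE//; apply: le_lt_trans (lt_trans lte (ltry _)); rewrite leeDr.
have finp : nX p \is a fin_num.
  by rewrite ge0_fin_numE ?qnorm_ge0//; exact: le_lt_trans pu fu.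
exists p, g, (fine (nX p)), (fine (nX g)); split.
- by split=> //; exact: upper_gradient_pos.
- by move=> x; rewrite le_max lexx orbT.
- by move=> x /uE u1; rewrite le_max u1.
- by rewrite !fineK.
- split; [by rewrite fine_ge0// qnorm_ge0|by rewrite fine_ge0|].
  rewrite -lte_fin EFinD !fineK//; apply: le_lt_trans lte.
  exact: leeD2r.
Qed.

Lemma capX_set0 : capX X set0 = 0%E.
Proof.
apply/eqP; rewrite eq_le capX_ge0 andbT.
have := @capX_le set0 _ _ (meas_fun_cst S 0%E) (upper_gradient_cst S 0).
by rewrite qnorm_cst0 adde0; apply.
Qed.

Lemma qnorm_max_le u v : meas_fun S u -> meas_fun S v ->
  (forall x, 0 <= u x)%E -> (forall x, 0 <= v x)%E ->
  (nX (fun x => maxe (u x) (v x)) <= c%:E * (nX u + nX v))%E.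
Proof.
move=> mu mv u0 v0; apply: le_trans (qnorm_quasi_tri X mu mv).
apply: le_qnorm; [exact: meas_fun_max|exact: meas_funD|move=> x].
rewrite !gee0_abs ?adde_ge0 ?le_max ?u0// ge_max.
by rewrite leeDl ?leeDr.
Qed.

(** The maximum of two admissible functions is admissible for the union, and both quasinorms cost
    the same factor [c]. *)
Lemma capX_setU_lt E F (e f : RR) :
  (capX X E < e%:E)%E -> (capX X F < f%:E)%E ->
  (capX X (E `|` F) < (c * (e + f))%:E)%E.
Proof.
move=> /capX_lt[u [g [a [b [[mu ug] u0 uE [ua gb] [a0 b0 abe]]]]]].
move=> /capX_lt[v [h [a' [b' [[mv vh] v0 vF [va hb] [a'0 b'0 abf]]]]]].
have EF x : (E `|` F) x -> (1 <= maxe (u x) (v x))%E.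
  by case=> [/uE|/vF] H; rewrite le_max H ?orbT.
have mg := upper_gradient_meas ug; have mh := upper_gradient_meas vh.
apply: (le_lt_trans (capX_le (meas_fun_max mu mv) (upper_gradient_max ug vh) EF)).
have [g0 _] := ug; have [h0 _] := vh.
apply: (le_lt_trans (leeD (qnorm_max_le mu mv u0 v0) (qnorm_max_le mg mh g0 h0))).
rewrite ua va gb hb -[ltLHS]/((c * (a + a') + c * (b + b'))%:E) lte_fin.
rewrite -mulrDr ltr_pM2l ?cwedge_gt0//.
by lra.
Qed.

(** With [k = 1/(n+1)], the maximum differs from [u] by at most [k u + vn n], whose quasinorm tends
    to 0; continuity of the quasinorm concludes. *)
Lemma qnorm_max_cvg u (vn : nat -> T -> \bar RR) : meas_fun S u ->
  (forall x, 0 <= u x)%E -> (nX u < +oo)%E -> (forall n, meas_fun S (vn n)) ->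
  (forall n x, 0 <= vn n x)%E -> (forall n, nX (vn n) <= (n.+1%:R^-1)%:E)%E ->
  nX (fun x => maxe ((1 + n.+1%:R^-1)%:E * u x) (vn n x))%E @[n --> \oo] --> nX u.
Proof.
move=> mu u0 fu mv v0 vle.
have k0 n : 0 < 1 + n.+1%:R^-1 :> RR by rewrite addr_gt0// invr_gt0.
have fin : nX u \is a fin_num by rewrite ge0_fin_numE ?qnorm_ge0.
have mw n : meas_fun S (fun x => maxe ((1 + n.+1%:R^-1)%:E * u x) (vn n x))%E.
  by apply: meas_fun_max => //; exact: meas_funZ.
apply: qnorm_cont => // [n|].
  split=> //; apply: (le_lt_trans (qnorm_max_le _ _ _ _)) => //.
  - exact: meas_funZ.
  - by move=> x; rewrite mule_ge0// lee_fin ltW.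
  rewrite qnorm_hom// -(fineK fin) -EFinM.
  apply: (@le_lt_trans _ _ (c%:E * ((`|1 + n.+1%:R^-1| * fine (nX u))%:E +
    (n.+1%:R^-1)%:E))%E); last by rewrite -EFinD -EFinM ltry.
  by rewrite lee_pmul2l ?lte_fin ?cwedge_gt0// leeD2l.
(* From [c (k ||u|| + k) = B k] with [k = 1/(n+1)]. *)
pose B := c * (fine (nX u) + 1).
apply: (@squeeze_cvge _ _ _ _ (fun=> 0%E) _ (fun n => (B * n.+1%:R^-1)%:E)).
- apply: nearW => n; rewrite qnorm_ge0/=; last exact: meas_funB.
  have -> : (B * n.+1%:R^-1)%:E =
      (c%:E * (`|n.+1%:R^-1|%:E * nX u + (n.+1%:R^-1)%:E))%E.
    rewrite ger0_norm ?invr_ge0// -(fineK fin).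
    rewrite -[RHS]/((c * (n.+1%:R^-1 * fine (nX u) + n.+1%:R^-1))%:E) /B.
    by congr EFin; ring.
  rewrite -qnorm_hom//.
  have mZ : meas_fun S (fun x => (n.+1%:R^-1)%:E * u x)%E by exact: meas_funZ.
  apply: le_trans (_ : (c%:E * (nX (fun x => (n.+1%:R^-1)%:E * u x) + nX (vn n)) <= _)%E);
    last by rewrite lee_pmul2l ?lte_fin ?cwedge_gt0// leeD2l.
  apply: le_trans (qnorm_quasi_tri X mZ (mv n)); apply: le_qnorm.
  + exact: meas_funB.
  + exact: meas_funD.
  move=> x; have k1 : 0 < n.+1%:R^-1 :> RR by rewrite invr_gt0.
  rewrite [leRHS]gee0_abs; last by rewrite adde_ge0// mule_ge0// lee_fin ltW.
  move: (u0 x) (v0 n x) k1; move: (n.+1%:R^-1) => k.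
  case: (u x) => [a| |]// a0.
    case: (vn n x) => [b| |]// b0 k1; last by rewrite [leRHS]addey ?leey.
    move: a0 b0; rewrite !lee_fin => a0 b0; rewrite -EFinM -EFin_max.
    rewrite -[leLHS]/(`|Num.max ((1 + k) * a) b - a|%:E).
    rewrite -[leRHS]/((k * a + b)%:E) lee_fin.
    have ka : 0 <= k * a by rewrite mulr_ge0// ltW.
    rewrite mulrDl mul1r ger0_norm; last first.
      by rewrite subr_ge0 le_max lerDl ka.
    by rewrite lerBlDr ge_max; apply/andP; split; lra.
  (* Where [u] is [+oo], the right side is [+oo] as well. *)
  move=> b0 k1; rewrite [X in (_ <= X + _)%E]gt0_muley ?lte_fin//.
  by rewrite addye ?leey// gt_eqF// (lt_le_trans _ b0)// ltNyr.
- exact: cvg_cst.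
- apply: cvg_EFin; first exact: nearW.
  rewrite -[X in _ --> X](mulr0 B); apply: cvgMr.
  exact: cvg_harmonic.
Qed.

(** Continuity of [u] controls only the nearby points outside [V]; the other nearby points lie in
    [V], which is part of the union. *)
Lemma open_superlevelU u V (k : RR) : is_open S V -> cont_off S u V ->
  is_open S ([set x | k%:E < u x]%E `|` V).
Proof.
move=> oV [finu cu] x Hx; have [Vx|Vx] := pselect (V x).
  by have [r [r0 rV]] := oV x Vx; exists r; split=> // y /rV; right.
case: Hx => [/= kx|//]; have fx := finu x Vx.
have e0 : 0 < fine (u x) - k by rewrite subr_gt0 -lte_fin fineK.
have [r [r0 rV]] := cu x Vx _ e0; exists r; split=> // y dxy.
have [Vy|Vy] := pselect (V y); first by right.
left=> /=; rewrite -(fineK (finu y Vy)) lte_fin.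
by have := rV y Vy dxy; rewrite ltr_norml => /andP[]; lra.
Qed.

Lemma is_openU E F : is_open S E -> is_open S F -> is_open S (E `|` F).
Proof.
move=> oE oF x [/oE|/oF] [r [r0 rH]]; exists r; split=> // y /rH; [left|right] => //.
Qed.

Lemma cont_off_subset u E F : E `<=` F -> cont_off S u E -> cont_off S u F.
Proof.
move=> EF [finu cu]; split=> [x Fx|x Fx e e0]; first by apply: finu => /EF.
have [r [r0 rH]] := cu x (fun Ex => Fx (EF x Ex)) e e0.
by exists r; split=> // y Fy; apply: rH => /EF.
Qed.

Lemma cont_off_eq u v E : (forall x, ~ E x -> u x = v x) ->
  cont_off S u E -> cont_off S v E.
Proof.
move=> uv [finu cu]; split=> [x Ex|x Ex e e0]; first by rewrite -uv// finu.
have [r [r0 rH]] := cu x Ex e e0; exists r; split=> // y Ey dxy.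
by rewrite -!uv//; exact: rH.
Qed.

(* If u is admissible for E and continuous off a small open set V, then u > 1/(1+t)
   together with V is an open neighbourhood of E, for which max((1+t)u, v) is
   admissible whenever v is admissible for V; continuity of the quasinorm lets
   t and the norm of v tend to 0. *)
Lemma propA_propB : propA X -> propB X.
Proof.
move=> hA E; apply: le_ereal_inf_tmp => _ [u [uN uE] <-].
have [[mu fu] _] := uN; have u0 := qnorm_ge0 X mu.
have finu : nX u \is a fin_num by rewrite ge0_fin_numE.
rewrite /N1norm -leeBlDl//; apply: le_ereal_inf_tmp => _ [g ug <-].
rewrite leeBlDl//; have mg := upper_gradient_meas ug.
have [->|fing] := eqVneq (nX g) +oo%E; first by rewrite addey ?leey// gt_eqF// (lt_le_trans _ u0).
have {}fing : (nX g < +oo)%E by rewrite ltey.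
(* The positive part keeps [g] as an upper gradient and does not increase the quasinorm;
   [qnorm_max_cvg] asks for nonnegative functions. *)
pose p x := maxe (u x) 0%E.
have mp : meas_fun S p by apply: meas_fun_max => //; exact: meas_fun_cst.
have pu : (nX p <= nX u)%E.
  apply: le_qnorm => // x; rewrite /p.
  by case: (leP (u x) 0%E) => // _; rewrite abse0.
have p0 x : (0 <= p x)%E by rewrite le_max lexx orbT.
have pg := upper_gradient_pos ug; have [g0 _] := ug.
have /choice[V hV] : forall n : nat, exists V, is_open S V /\
    (capX X V < (n.+1%:R^-1)%:E)%E /\ cont_off S u V.
  by move=> n; apply: hA => //; rewrite invr_gt0.
have /choice[vh hvh] : forall n : nat, exists vh : (T -> \bar RR) * (T -> \bar RR),
    [/\ meas_fun S vh.1 /\ upper_gradient S vh.1 vh.2, (forall x, 0 <= vh.1 x)%E,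
     (forall x, V n x -> 1 <= vh.1 x)%E, (nX vh.1 <= (n.+1%:R^-1)%:E)%E &
     (nX vh.2 <= (n.+1%:R^-1)%:E)%E].
  move=> n; have [_ [/capX_lt[v [h [a [b [vm v0 vV [va hb] [a0 b0 ab]]]]]] _]] := hV n.
  by exists (v, h); split=> //=; rewrite ?va ?hb lee_fin;
    apply: le_trans (ltW ab); rewrite ?lerDl ?lerDr.
pose k n : RR := 1 + n.+1%:R^-1.
have k0 n : 0 < k n by rewrite addr_gt0// invr_gt0.
pose w n x := maxe ((k n)%:E * p x)%E ((vh n).1 x).
pose q n x := maxe ((k n)%:E * g x)%E ((vh n).2 x).
have le n : (outer_inf X E <= nX (w n) + nX (q n))%E.
  have [[mv vg] v0 vV _ _] := hvh n; have [oV [_ cV]] := hV n.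
  apply: (@le_trans _ _ (capX X ([set x | ((k n)^-1)%:E < u x]%E `|` V n))).
    apply: ereal_inf_lbound; eexists; last by [].
    split; first exact: open_superlevelU.
    move=> x /uE u1; left=> /=; apply: lt_le_trans u1.
    by rewrite lte_fin invf_lt1// /k ltrDl invr_gt0.
  apply: capX_le.
  - by apply: meas_fun_max => //; exact: meas_funZ.
  - by apply: upper_gradient_max => //; exact: upper_gradientZ.
  - move=> x [/= kx|/vV v1]; last by rewrite /w le_max v1 orbT.
    rewrite /w le_max; apply/orP; left; rewrite -lee_pdivrMl// mule1.
    by rewrite /p le_max (ltW kx).
have cw : nX (w n) @[n --> \oo] --> nX p.
  apply: qnorm_max_cvg => //; first exact: le_lt_trans pu fu.
  + by move=> n; have [[]] := hvh n.
  + by move=> n; have [] := hvh n.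
  + by move=> n; have [] := hvh n.
have cq : nX (q n) @[n --> \oo] --> nX g.
  apply: qnorm_max_cvg => //.
  + by move=> n; have [[_ /upper_gradient_meas]] := hvh n.
  + by move=> n; have [[_ []]] := hvh n.
  + by move=> n; have [] := hvh n.
have fp : nX p \is a fin_num.
  by rewrite ge0_fin_numE ?qnorm_ge0//; exact: le_lt_trans pu fu.
apply: le_trans (leeD2r (nX g) pu).
have cc : (nX (w n) + nX (q n))%E @[n --> \oo] --> (nX p + nX g)%E.
  exact: cvgeD (fin_num_adde_defr (nX g) fp) cw cq.
rewrite -(cvg_lim _ cc)//; apply: lime_ge; first by apply/cvg_ex; eexists; exact: cc.
exact: nearW.
Qed.

Lemma propB_propC : propB X -> propC X.
Proof. by move=> hB; exists 1; split=> // E; rewrite mul1e. Qed.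

(** Start from an exceptional set of capacity below [e / k]: the open set around it supplied by (C)
    has capacity below [e], and continuity survives enlarging the exceptional set. *)
Lemma propC_propD : propC X -> propD X.
Proof.
move=> [k [k1 hk]] u wu e e0; have k0 : 0 < k by exact: lt_le_trans ltr01 k1.
have ek : 0 < k^-1 * e by rewrite mulr_gt0// invr_gt0.
have [E [capE cE]] := wu _ ek.
have /ereal_inf_lt[_ [G [oG EG] <-] capG] : (outer_inf X E < e%:E)%E.
  by apply: le_lt_trans (hk E) _; rewrite -lte_pdivlMl// -EFinM.
by exists G; split=> //; split=> //; exact: cont_off_subset cE.
Qed.

(* Continuity off G includes finiteness off G. *)
Lemma propD_propE : propD X -> propE X.
Proof.
move=> hD E cE e e0; pose u x : \bar RR := if `[< E x >] then +oo%E else 0%E.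
have [|G [oG [capG [finG _]]]] := hD u _ e e0.
  move=> f f0; exists E; split; first by rewrite cE.
  split=> [x Ex|x Ex r r0]; rewrite /u asboolF//.
  by exists 1; split=> // y Ey _; rewrite asboolF// subrr normr0.
exists G; split=> //; split=> // x Ex; apply: contrapT => /finG.
by rewrite /u asboolT.
Qed.

Lemma propA_propF : propA X -> propF X.
Proof.
move=> hA u /hA qu; exists u; split=> //.
by exists set0; split=> //; exact: capX_set0.
Qed.

(** Chooses [f] so that [capX_setU_lt], applied to two sets of capacity below [f], returns exactly
    [e]. *)
Lemma cwedge_split (e : RR) : 0 < e -> exists2 f : RR, 0 < f & c * (f + f) = e.
Proof.
move=> e0; exists (e / (2 * c)); first by rewrite divr_gt0// mulr_gt0// cwedge_gt0.
by have := cwedge_gt0; move=> ?; field; rewrite gt_eqF.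
Qed.

Lemma propF_propG : propF X -> propG X.
Proof.
move=> hF u /hF[v [qv [N [N0 vu]]]] e /cwedge_split[f f0 <-].
have [E [_ [capE cE]]] := qv f f0.
exists (E `|` N); split; first by apply: capX_setU_lt; rewrite ?N0.
apply: (@cont_off_eq v) => [x nEN|]; first by apply: vu => Nx; apply: nEN; right.
by apply: cont_off_subset cE; left.
Qed.

(** The exceptional set of [v] is open by (F), and (E) encloses the null set where [v] and [u]
    differ in a small open set; their union serves for [u]. *)
Lemma propEF_propA : propE X -> propF X -> propA X.
Proof.
move=> hE hF u /hF[v [qv [N [N0 vu]]]] e /cwedge_split[f f0 <-].
have [E [oE [capE cE]]] := qv f f0.
have [G [oG [NG capG]]] := hE N N0 f f0.
exists (E `|` G); split; first exact: is_openU.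
split; first exact: capX_setU_lt.
apply: (@cont_off_eq v) => [x nEG|]; first by apply: vu => /NG Gx; apply: nEG; right.
by apply: cont_off_subset cE; left.
Qed.

Lemma propDG_propA : propD X -> propG X -> propA X.
Proof. by move=> hD hG u /hG; exact: hD. Qed.

Lemma property_implications :
  ((propD X /\ propG X) <-> (propE X /\ propF X)) /\
  ((propE X /\ propF X) <-> propA X) /\
  (propA X -> propB X) /\ (propB X -> propC X) /\
  (propC X -> propD X) /\ (propD X -> propE X) /\
  (propA X -> propF X) /\ (propF X -> propG X).
Proof.
have AB := propA_propB; have BC := propB_propC; have CD := propC_propD.
have DE := propD_propE; have AF := propA_propF; have FG := propF_propG.
have EFA := propEF_propA; have DGA := propDG_propA.
(* The equivalences close because (A) gives (D) and (E) through (B) and (C), and (G) through (F). *)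
by split; tauto.
Qed.

End Capacity.

(** * Countable spaces: no nonconstant rectifiable curves *)

Lemma lipschitz1_continuous (R : realType) (f : R -> R) :
  (forall s t, s <= t -> `|f s - f t| <= t - s) -> continuous f.
Proof.
move=> lip s; apply/cvgrPdist_lt => e e0; near=> t.
apply: (@le_lt_trans _ _ `|s - t|); last by near: t; exact: cvgr_dist_lt.
case: (leP s t) => st.
  by rewrite [leRHS]distrC; apply: le_trans (lip _ _ st) (ler_norm _).
by rewrite distrC; apply: le_trans (lip _ _ (ltW st)) (ler_norm _).
Unshelve. all: by end_near.
Qed.

Section CountableSpaces.
Context (T : countType) (S : mms T).

Lemma arclength_dist_le (gamma : RR -> T) (l s t : RR) :
  arclength_param S gamma l -> 0 <= s -> s <= t -> t <= l ->
  dist S (gamma s) (gamma t) <= t - s.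
Proof.
move=> al s0 st tl; rewrite -lee_fin -(al s t s0 st tl).
(* The partition with a single step: a chord is at most its arc. *)
apply: ereal_sup_ubound; exists 1%N, (fun i => if i == 0%N then s else t).
by do !split => //; [case|rewrite big_ord1].
Qed.

(* By the intermediate value theorem, the distance to the starting point of a
   nonconstant curve takes uncountably many values. *)
Lemma countable_no_curve (gamma : RR -> T) (l : RR) :
  0 < l -> ~ arclength_param S gamma l.
Proof.
move=> l0 al.
(* Otherwise [gamma] is constant on [[0, l]] and all polygonal sums vanish, although its length is
   [l > 0]. *)
have [t [t0 tl /eqP ft]] : exists t, [/\ 0 <= t, t <= l & dist S (gamma 0) (gamma t) <> 0].
  apply: contrapT => H.
  have cst t : 0 <= t -> t <= l -> gamma t = gamma 0.
    move=> t0 tl; apply: contrapT => ne; apply: H; exists t; split=> //.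
    by move/dist_eq0 => e; apply: ne.
  have := al _ _ (lexx (0 : RR)) (ltW l0) (lexx _).
  have : (curve_length S gamma 0%R l <= 0)%E.
    apply: ge_ereal_sup => _ [n [p [p0 [pn [mono ->]]]]].
    have mono2 i j : (i <= j <= n)%N -> p i <= p j.
      elim: j => [|j IH] /andP[ij jn]; first by rewrite leqn0 in ij; rewrite (eqP ij).
      move: ij; rewrite leq_eqVlt => /orP[/eqP->//|ij].
      by rewrite (le_trans (IH _))// ?mono//; apply/andP; split=> //; exact: ltnW.
    have pE i : (i <= n)%N -> gamma (p i) = gamma 0.
      move=> ilen; apply: cst; first by rewrite -p0 mono2.
      by rewrite -pn mono2// ilen leqnn.
    rewrite lee_fin big1// => -[i ilt] _ /=; apply/dist_eq0.
    by rewrite !pE// ltnW.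
  by move=> /[swap] ->; rewrite lee_fin subr0 leNgt l0.
(* Clamping to [[0, l]] makes [f] 1-Lipschitz on the whole line, while [gamma] is controlled only on
   the interval. *)
pose cl s : RR := Num.max 0 (Num.min s l).
pose f s := dist S (gamma 0) (gamma (cl s)).
have cl0 s : 0 <= cl s by rewrite le_max lexx.
have cll s : cl s <= l by rewrite ge_max ltW//= ge_min lexx orbT.
have cl_mono s s' : s <= s' -> 0 <= cl s' - cl s <= s' - s.
  move=> ss'; have : 0 <= Num.min s' l - Num.min s l <= s' - s.
    by case: (leP s l) => ?; case: (leP s' l) => ?; apply/andP; split; lra.
  rewrite /cl; move: (Num.min s l) (Num.min s' l) => a b /andP[ab1 ab2].
  by case: (leP 0 a) => ?; case: (leP 0 b) => ?; apply/andP; split; lra.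
have lip s s' : s <= s' -> `|f s - f s'| <= s' - s.
  move=> ss'; have /andP[c1 c2] := cl_mono _ _ ss'.
  apply: le_trans c2; have := arclength_dist_le al (cl0 s) (_ : cl s <= cl s') (cll s').
  rewrite -subr_ge0 => /(_ c1); apply: le_trans.
  have := dist_tri S (gamma 0) (gamma (cl s)) (gamma (cl s')).
  have := dist_tri S (gamma 0) (gamma (cl s')) (gamma (cl s)).
  rewrite (dist_sym S (gamma (cl s')) (gamma (cl s))) -/(f s) -/(f s') ler_norml => ? ?.
  by apply/andP; split; lra.
have fc : continuous f := lipschitz1_continuous lip.
have ft_gt0 : 0 < f t.
  rewrite lt_neqAle dist_ge0 andbT eq_sym /f.
  by rewrite (_ : cl t = t)// /cl (min_idPl tl); apply/max_idPr.
have f0 : f 0 = 0.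
  by apply/dist_eq0; rewrite /cl; congr gamma; rewrite min_l ?ltW// maxxx.
have cov : `[0, f t]%classic `<=` dist S (gamma 0) @` setT.
  move=> v /=; rewrite in_itv/= => /andP[v0 vt].
  have [|c _ <-] := @IVT RR f 0 t v t0 (continuous_subspaceT fc).
    by rewrite f0 (min_idPl (ltW ft_gt0)) (max_idPr (ltW ft_gt0)) v0 vt.
  by exists (gamma (cl c)).
(* The interval would be countable, hence Lebesgue null, but its measure is [f t > 0]. *)
have cnt : countable `[0, f t]%classic.
  exact: sub_countable (card_le_trans (subset_card_le cov) (card_image_le _ _)) (countableP _).
have := countable_lebesgue_measure0 cnt.
rewrite lebesgue_measure_itv/= lte_fin ft_gt0 sube0 => -[] e.
by move: ft_gt0; rewrite e ltxx.
Qed.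

Context (X : qbfl S).

Lemma countable_upper_gradient0 (u : T -> \bar RR) : upper_gradient S u (fun=> 0%E).
Proof.
split=> //; split; first exact: borel_fun_cst.
by move=> gam l l0 /(countable_no_curve l0).
Qed.

Lemma countable_N1norm (u : T -> \bar RR) : meas_fun S u -> N1norm X u = qnorm X u.
Proof.
move=> mu; apply/eqP; rewrite eq_le; apply/andP; split.
  by have := N1norm_le X (countable_upper_gradient0 u); rewrite qnorm_cst0 adde0.
rewrite /N1norm leeDl//; apply: le_ereal_inf_tmp => _ [g ug <-].
exact/qnorm_ge0/(upper_gradient_meas ug).
Qed.

Lemma countable_in_N1X (u : T -> \bar RR) :
  in_N1X X u <-> meas_fun S u /\ (qnorm X u < +oo)%E.
Proof. by split=> [[]//|[mu fu]]; split=> //; rewrite countable_N1norm. Qed.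

End CountableSpaces.

(* Row k is a convergent sequence: as 0^-1 = 0, the point (k, 0) is the limit of
   the isolated points (k, n), n > 0. *)
Definition rows_dist (x y : nat * nat) : RR :=
  `|x.1%:R - y.1%:R| + `|x.2%:R^-1 - y.2%:R^-1|.

Lemma rows_dist_ge0 x y : 0 <= rows_dist x y.
Proof. by rewrite addr_ge0. Qed.

Lemma rows_dist_eq0 x y : rows_dist x y = 0 <-> x = y.
Proof.
split=> [/eqP|->]; last by rewrite /rows_dist !subrr normr0 addr0.
rewrite paddr_eq0// !normr_eq0 !subr_eq0 eqr_nat => /andP[/eqP e1 /eqP/invr_inj/eqP].
by rewrite eqr_nat => /eqP e2; case: x y e1 e2 => [? ?] [? ?] /= -> ->.
Qed.

Lemma rows_dist_sym x y : rows_dist x y = rows_dist y x.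
Proof. by rewrite /rows_dist distrC [X in _ + X]distrC. Qed.

Lemma rows_dist_tri x y z : rows_dist x z <= rows_dist x y + rows_dist y z.
Proof.
rewrite /rows_dist addrACA; apply: lerD; exact: ler_distD.
Qed.

(** Distinct naturals are at least 1 apart. Hence continuity can be examined row by row. *)
Lemma rows_dist_row x y : rows_dist x y < 1 -> x.1 = y.1.
Proof.
move=> xy; apply/eqP; apply: contraT => ne.
have {}xy : `|x.1%:R - y.1%:R| < 1 :> RR by apply: le_lt_trans xy; rewrite lerDl.
suff : 1 <= `|x.1%:R - y.1%:R| :> RR by rewrite leNgt xy.
move: ne; rewrite neq_ltn => /orP[] h; move: h; rewrite -(ler_nat RR) -natr1 => h.
  by rewrite distrC; apply: le_trans (ler_norm _); lra.
by apply: le_trans (ler_norm _); lra.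
Qed.

Lemma rows_dist_limit k n : rows_dist (k, 0%N) (k, n) = n%:R^-1.
Proof. by rewrite /rows_dist subrr normr0 invr0 add0r sub0r normrN ger0_norm. Qed.

Lemma rows_dist_limit_lt k (r : RR) : 0 < r ->
  exists N, forall n, (N <= n)%N -> rows_dist (k, 0%N) (k, n.+1) < r.
Proof.
move=> r0; exists (Num.truncn r^-1) => n hn; rewrite rows_dist_limit invf_plt ?posrE//.
by rewrite (lt_le_trans (truncnS_gt _))// ler_nat.
Qed.

Lemma rows_isolated k n : exists2 r, 0 < r &
  forall y, rows_dist (k, n.+1) y < r -> y = (k, n.+1).
Proof.
pose N : RR := n.+1%:R; have N1 : 1 <= N by rewrite ler1n.
(* The radius is [1/N - 1/(N+1)], the distance to the nearest other point [(k, n.+2)]. *)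
have r0 : 0 < (N * (N + 1))^-1 by rewrite invr_gt0 mulr_gt0//; lra.
exists (N * (N + 1))^-1 => // -[j m] xy.
have jk : k = j.
  apply: (@rows_dist_row (k, n.+1) (j, m)); apply: (lt_le_trans xy).
  by rewrite invf_le1 ?mulr_gt0//; nra.
move: xy; rewrite -jk /rows_dist subrr normr0 add0r /= => xy.
congr (_, _); apply/eqP; apply: contraTT xy => mn; rewrite -leNgt -/N.
case: m mn => [|m] mn.
  rewrite invr0 subr0 ger0_norm ?invr_ge0; last lra.
  by rewrite lef_pV2 ?posrE ?mulr_gt0//; nra.
pose M : RR := m.+1%:R; rewrite -/M; have M1 : 1 <= M by rewrite ler1n.
have M0 : 0 < M by lra.
have N0 : 0 < N by lra.
have -> : N^-1 - M^-1 = (M - N) / (M * N) by field; rewrite !gt_eqF.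
rewrite normrM normfV (gtr0_norm (mulr_gt0 M0 N0)) ler_pdivlMr ?mulr_gt0//.
have -> : (N * (N + 1))^-1 * (M * N) = M / (N + 1) by field; rewrite !gt_eqF//; lra.
rewrite ler_pdivrMr; last lra.
(* With denominators cleared, the claim is [M <= |M - N| (N + 1)] for naturals that differ. *)
move: mn; rewrite neq_ltn => /orP[] h; move: h; rewrite -(ler_nat RR) -natr1 -/M -/N => h.
  rewrite distrC; apply: (@le_trans _ _ ((N - M) * (N + 1))); first nra.
  by rewrite ler_pM2r ?ler_norm//; lra.
apply: (@le_trans _ _ ((M - N) * (N + 1))); first nra.
by rewrite ler_pM2r ?ler_norm//; lra.
Qed.

(** * Weighted sup-norm lattices on the rows *)

Section WeightedRows.
Context (w : nat * nat -> RR).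
Hypothesis w_ge0 : forall x, 0 <= w x.
Hypothesis w_gt0 : forall k n, 0 < w (k, n.+1).
Let T := (nat * nat)%type.
Implicit Types (u v : T -> \bar RR) (A B E G : set T) (x : T).

(** Powers of 1/2 along the injection [pickle] keep the total mass finite; the mass vanishes exactly
    with the weight, so that null functions are those of norm 0. *)
Definition rows_mass x : \bar RR :=
  if w x == 0 then 0%E else (1 / (2 ^ (pickle x + 1))%:R)%:E.

Definition rows_mu A : \bar RR := \esum_(x in A) rows_mass x.

Lemma rows_mass_ge0 x : (0 <= rows_mass x)%E.
Proof. by rewrite /rows_mass; case: ifP => // _; rewrite lee_fin divr_ge0. Qed.

Lemma rows_mass_gt0 x : w x != 0%R -> (0 < rows_mass x)%E.
Proof. by rewrite /rows_mass => /negbTE->; rewrite lte_fin divr_gt0// ltr0n expn_gt0. Qed.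

Lemma le_rows_mu A B : A `<=` B -> (rows_mu A <= rows_mu B)%E.
Proof.
move=> AB; apply: ereal_sup_le => _ [F [finF FA] <-]; exists F => //.
by split=> //; exact: subset_trans AB.
Qed.

Lemma rows_mu_point A x : A x -> (rows_mass x <= rows_mu A)%E.
Proof.
move=> Ax; rewrite -(@esum_set1 _ _ x rows_mass (rows_mass_ge0 x)).
by apply: le_rows_mu => _ ->.
Qed.

Lemma rows_mu_lty A : (rows_mu A < +oo)%E.
Proof.
apply: le_lt_trans (le_rows_mu (@subsetT _ A)) _.
pose b n : \bar RR := (1 / (2 ^ (n + 1))%:R)%:E.
have b0 n : (0 <= b n)%E by rewrite lee_fin divr_ge0.
apply: (@le_lt_trans _ _ (\esum_(x in [set: T]) b (pickle x))).
  by apply: le_esum => x _; rewrite /rows_mass; case: ifP => // _; exact: b0.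
rewrite -(esum_image setT pickle b); last first.
  by move=> x y _ _ /(pcan_inj pickleK).
apply: (@le_lt_trans _ _ (\esum_(n in [set: nat]) b n)).
  apply: ereal_sup_le => _ [F [finF FA] <-]; exists F => //.
rewrite -nneseries_esumT//.
have h := @cvg_geometric_eseries_half RR 1 0.
have -> : (\sum_(0 <= n <oo) b n)%E = (1 / 2 ^+ 0 : RR)%:E by apply/cvg_lim.
exact: ltry.
Qed.

Lemma rows_mu_sigma_additive (F : nat -> set T) : trivIset setT F ->
  (fun n => (\sum_(i < n) rows_mu (F i))%E) @ \oo --> rows_mu (\bigcup_n F n).
Proof.
move=> tF; rewrite /rows_mu esum_bigcupT//; last exact: rows_mass_ge0.
have F0 n : (0 <= \esum_(j in F n) rows_mass j)%E.
  by apply: esum_ge0 => x _; exact: rows_mass_ge0.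
rewrite -nneseries_esumT// (_ : (fun n => _) =
    (fun n => \sum_(0 <= i < n) \esum_(j in F i) rows_mass j)%E); last first.
  by apply/funext => n; rewrite big_mkord.
by apply: is_cvg_nneseries => n _ _; exact: F0.
Qed.

(** The centre may be a limit of weight 0; its balls get positive mass from the isolated points
    nearby. *)
Lemma rows_mu_ball x (r : RR) : 0 < r ->
  (0 < rows_mu (ball_d rows_dist x r))%E /\ (rows_mu (ball_d rows_dist x r) < +oo)%E.
Proof.
move=> r0; split; last exact: rows_mu_lty.
suff [y By wy] : exists2 y, ball_d rows_dist x r y & w y != 0.
  exact: lt_le_trans (rows_mass_gt0 wy) (rows_mu_point By).
case: x => k [|n].
  have [N hN] := rows_dist_limit_lt k r0; exists (k, N.+1); first exact: hN.
  by rewrite gt_eqF.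
exists (k, n.+1); last by rewrite gt_eqF.
by rewrite /ball_d /= (rows_dist_eq0 _ _).2.
Qed.

Lemma sigma_algebra_all : sigma_algebra setT (@setT (set T)).
Proof. by []. Qed.

Definition rows_mms : mms T :=
  @MMS T rows_dist setT rows_mu rows_dist_ge0 rows_dist_eq0 rows_dist_sym rows_dist_tri
    sigma_algebra_all (fun _ _ => I) (esum_set0 _)
    (fun A _ => esum_ge0 (fun x _ => rows_mass_ge0 x))
    (fun F _ tF => rows_mu_sigma_additive tF) (fun _ _ _ _ _ => I) rows_mu_ball.

Lemma rows_meas u : meas_fun rows_mms u.
Proof. by []. Qed.

Lemma rows_aeP (P : T -> Prop) : ae rows_mms P <-> forall x, w x != 0%R -> P x.
Proof.
split=> [aeP x wx|H].
  apply: contrapT => nP; have : (rows_mass x <= mu_out rows_mms [set x | ~ P x])%E.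
    by apply: le_ereal_inf_tmp => _ [A [_ sA] <-]; apply: rows_mu_point; exact: sA.
  by rewrite aeP leNgt rows_mass_gt0.
apply/eqP; rewrite eq_le; apply/andP; split; last first.
  by apply: le_ereal_inf_tmp => _ [A _ <-]; apply: esum_ge0 => x _; exact: rows_mass_ge0.
apply: ereal_inf_lbound; exists [set x | ~ P x]; first by split.
apply: esum1 => x /= nP; rewrite /rows_mass; case: eqVneq => // wx.
by case: nP; exact: H.
Qed.

(** By the convention [0 * +oo = 0], points of weight 0 do not contribute even where [u] is
    infinite. *)
Definition rows_norm u : \bar RR := ereal_sup (range (fun x => (w x)%:E * `|u x|)%E).

Lemma rows_norm_ub u x : ((w x)%:E * `|u x| <= rows_norm u)%E.
Proof. by apply: ereal_sup_ubound; exists x. Qed.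

Lemma rows_norm_le u (M : \bar RR) :
  (0 <= M)%E -> (forall x, w x != 0%R -> (w x)%:E * `|u x| <= M)%E -> (rows_norm u <= M)%E.
Proof.
move=> M0 H; apply: ge_ereal_sup => _ [x _ <-]; have [->|wx] := eqVneq (w x) 0.
  by rewrite mul0e.
exact: H.
Qed.

Lemma rows_norm_ge0 u : (0 <= rows_norm u)%E.
Proof.
apply: le_trans (rows_norm_ub u (0%N, 0%N)); rewrite mule_ge0 ?lee_fin//.
Qed.

Lemma rows_weight_gt0 x : w x != 0%R -> 0 < w x.
Proof. by move=> wx; rewrite lt_neqAle eq_sym wx w_ge0. Qed.

Lemma rows_norm_eq0 u : rows_norm u = 0%E <-> ae rows_mms (fun x => u x = 0%E).
Proof.
split=> [u0|/rows_aeP u0].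
  apply/rows_aeP => x wx; have := rows_norm_ub u x; rewrite u0 => h.
  apply/eqP; rewrite -abse_eq0 eq_le abse_ge0 andbT.
  by rewrite -(mule0 (w x)%:E) lee_pmul2l ?lte_fin ?rows_weight_gt0 in h.
apply/eqP; rewrite eq_le rows_norm_ge0 andbT; apply: rows_norm_le => // x /u0 ->.
by rewrite abse0 mule0.
Qed.

Lemma rows_norm_hom (a : RR) u :
  rows_norm (fun x => (a%:E * u x)%E) = (`|a|%:E * rows_norm u)%E.
Proof.
have [->|a0] := eqVneq a 0.
  rewrite normr0 mul0e; apply/rows_norm_eq0/rows_aeP => x _; exact: mul0e.
have na : 0 < `|a| by rewrite normr_gt0.
have E x : ((w x)%:E * `|a%:E * u x| = `|a|%:E * ((w x)%:E * `|u x|))%E.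
  by rewrite abseM muleCA.
apply/eqP; rewrite eq_le; apply/andP; split.
  apply: rows_norm_le => [|x _]; first by rewrite mule_ge0 ?lee_fin ?rows_norm_ge0.
  by rewrite E lee_pmul2l//; exact: rows_norm_ub.
rewrite -lee_pdivlMl//; apply: rows_norm_le => [|x _].
  by rewrite mule_ge0 ?rows_norm_ge0// lee_fin invr_ge0.
by rewrite lee_pdivlMl// -E; exact: rows_norm_ub.
Qed.

Lemma rows_normD u v :
  (rows_norm (fun x => u x + v x) <= rows_norm u + rows_norm v)%E.
Proof.
apply: rows_norm_le => [|x _]; first by rewrite adde_ge0 ?rows_norm_ge0.
apply: le_trans (leeD (rows_norm_ub u x) (rows_norm_ub v x)).
by rewrite -ge0_muleDr ?abse_ge0// lee_wpmul2l ?lee_fin ?lee_abs_add.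
Qed.

Lemma le_rows_norm u v : (forall x, w x != 0%R -> `|u x| <= `|v x|)%E ->
  (rows_norm u <= rows_norm v)%E.
Proof.
move=> uv; apply: rows_norm_le => [|x wx]; first exact: rows_norm_ge0.
by apply: le_trans (rows_norm_ub v x); rewrite lee_wpmul2l ?lee_fin ?uv.
Qed.

Lemma rows_norm_series (un : nat -> T -> \bar RR) :
  (forall n x, w x != 0%R -> 0 <= un n x)%E ->
  (rows_norm (fun x => \sum_(0 <= n <oo) un n x) <=
    \sum_(0 <= n <oo) rows_norm (un n))%E.
Proof.
move=> un0; apply: rows_norm_le => [|x wx].
  by apply: nneseries_ge0 => n _ _; exact: rows_norm_ge0.
rewrite gee0_abs; last by apply: nneseries_ge0 => n _ _; exact: un0.
rewrite -nneseriesZl; last by move=> n _; exact: un0.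
apply: lee_nneseries => n _; first by rewrite mule_ge0 ?lee_fin ?un0.
by apply: le_trans (rows_norm_ub (un n) x); rewrite gee0_abs// un0.
Qed.

Lemma rows_norm_fin u x : (rows_norm u < +oo)%E -> w x != 0%R -> u x \is a fin_num.
Proof.
move=> fu wx; have := le_lt_trans (rows_norm_ub u x) fu.
by case: (u x) => [//||] /=; rewrite gt0_muley ?lte_fin ?rows_weight_gt0.
Qed.

(** Squeeze by the two-sided triangle inequality. Finite norm forces finite values at points of
    positive weight, so differences cancel there as for reals. *)
Lemma rows_norm_cont (un : nat -> T -> \bar RR) u :
  (rows_norm u < +oo)%E -> (forall n, rows_norm (un n) < +oo)%E ->
  (fun n => rows_norm (fun x => un n x - u x)%E) @ \oo --> 0%E ->
  (fun n => rows_norm (un n)) @ \oo --> rows_norm u.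
Proof.
move=> fu fun_ cv; pose e n := rows_norm (fun x => un n x - u x)%E.
have finu : rows_norm u \is a fin_num by rewrite ge0_fin_numE ?rows_norm_ge0.
have finun n : rows_norm (un n) \is a fin_num by rewrite ge0_fin_numE ?rows_norm_ge0.
have efin n : e n \is a fin_num.
  rewrite ge0_fin_numE ?rows_norm_ge0//.
  apply: le_lt_trans (rows_normD (un n) (fun x => - u x)%E) _.
  rewrite lte_add_pinfty//; apply: le_lt_trans fu.
  by apply: le_rows_norm => x _; rewrite abseN.
apply: (@squeeze_cvge _ _ _ _ (fun n => rows_norm u - e n)%E _
                              (fun n => rows_norm u + e n)%E).
- apply: nearW => n; apply/andP; split.
    rewrite leeBlDr//.
    pose v x := (- (un n x - u x))%E.
    apply: (@le_trans _ _ (rows_norm (fun x => un n x + v x)%E)).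
      apply: le_rows_norm => x wx; rewrite /v.
      have := rows_norm_fin fu wx; have := rows_norm_fin (fun_ n) wx.
      case: (u x) (un n x) => [a||] [b||]//= _ _; rewrite lee_fin.
      by rewrite opprB addrC subrK.
    apply: le_trans (rows_normD _ _) _; apply: leeD => //.
    by apply: le_rows_norm => x _; rewrite abseN.
  apply: le_trans (rows_normD _ _); apply: le_rows_norm => x wx.
  have := rows_norm_fin fu wx; have := rows_norm_fin (fun_ n) wx.
  case: (u x) (un n x) => [a||] [b||]//= _ _; rewrite lee_fin.
  by rewrite addrC subrK.
- rewrite -[X in _ --> X]sube0; apply: cvgeB => //; last exact: cvg_cst.
  by rewrite fin_num_adde_defl.
- rewrite -[X in _ --> X]adde0; apply: cvgeD => //; last exact: cvg_cst.
  by rewrite fin_num_adde_defl.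
Qed.

Fact rows_quasi_tri u v : meas_fun rows_mms u -> meas_fun rows_mms v ->
  (rows_norm (fun x => u x + v x) <= 1%:E * (rows_norm u + rows_norm v))%E.
Proof. by move=> _ _; rewrite mul1e; exact: rows_normD. Qed.

Fact rows_lattice u v : meas_fun rows_mms u -> meas_fun rows_mms v ->
  ae rows_mms (fun x => (`|u x| <= `|v x|)%E) -> (rows_norm u <= rows_norm v)%E.
Proof. by move=> _ _ /rows_aeP; exact: le_rows_norm. Qed.

Fact rows_series (un : nat -> T -> \bar RR) :
  (forall n, meas_fun rows_mms (un n)) ->
  (forall n, ae rows_mms (fun x => (0 <= un n x)%E)) ->
  (rows_norm (fun x => \sum_(0 <= n <oo) un n x) <=
    \sum_(0 <= n <oo) ((1 ^+ n.+1 : RR)%:E * rows_norm (un n)))%E.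
Proof.
move=> _ un0; under [leRHS]eq_eseriesr do rewrite expr1n mul1e.
by apply: rows_norm_series => n; exact/rows_aeP.
Qed.

Fact rows_cont (un : nat -> T -> \bar RR) u :
  meas_fun rows_mms u -> (rows_norm u < +oo)%E ->
  (forall n, meas_fun rows_mms (un n) /\ (rows_norm (un n) < +oo)%E) ->
  (fun n => rows_norm (fun x => un n x - u x)%E) @ \oo --> 0%E ->
  (fun n => rows_norm (un n)) @ \oo --> rows_norm u.
Proof. by move=> _ fu fun_; apply: rows_norm_cont => // n; have [] := fun_ n. Qed.

Definition rows_lat : qbfl rows_mms :=
  @QBFL T rows_mms rows_norm 1 (lexx 1)
    (fun u _ => rows_norm_ge0 u) (fun u _ => rows_norm_eq0 u)
    (fun a u _ => rows_norm_hom a u) rows_quasi_tri rows_lattice rows_series rows_cont.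

Lemma rows_in_N1X u : in_N1X rows_lat u <-> (rows_norm u < +oo)%E.
Proof.
by split=> [/countable_in_N1X[]//|fu]; apply/countable_in_N1X.
Qed.

Lemma rows_in_N1X_bounded u (M : RR) :
  (forall x, (w x)%:E * `|u x| <= M%:E)%E -> in_N1X rows_lat u.
Proof.
move=> uM; apply/rows_in_N1X; apply: le_lt_trans (ltry M).
by apply: ge_ereal_sup => _ [x _ <-].
Qed.

Lemma rows_capX_ge E x : E x -> ((w x)%:E <= capX rows_lat E)%E.
Proof.
move=> Ex; apply: le_ereal_inf_tmp => _ [u [uN uE] <-].
rewrite countable_N1norm//; apply: le_trans (rows_norm_ub u x).
rewrite -[leLHS]mule1 lee_wpmul2l ?lee_fin//.
exact: le_trans (uE x Ex) (lee_abs _).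
Qed.

(** The indicator of [E] is admissible, with upper gradient 0. *)
Lemma rows_capX_le E (M : RR) :
  0 <= M -> (forall x, E x -> w x <= M) -> (capX rows_lat E <= M%:E)%E.
Proof.
move=> M0 EM; pose u x : \bar RR := (\1_E x)%:E.
have := @capX_le T rows_mms rows_lat E u _ (@rows_meas u)
  (countable_upper_gradient0 rows_mms u).
rewrite qnorm_cst0 adde0 => /(_ _)/le_trans; apply.
  by move=> x Ex; rewrite /u indicE mem_set.
apply: rows_norm_le => // x _; rewrite /u indicE; case: (boolP (x \in E)) => [|_].
  by rewrite inE => /EM wM; rewrite abse1 mule1 lee_fin.
by rewrite abse0 mule0.
Qed.

Lemma rows_open_limit G k : is_open rows_mms G -> G (k, 0%N) ->
  exists N, forall n, (N <= n)%N -> G (k, n.+1).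
Proof.
move=> oG /oG[r [/(rows_dist_limit_lt k)[N hN] rG]].
by exists N => n /hN; exact: rG.
Qed.

Lemma rows_openT : is_open rows_mms setT.
Proof. by move=> x _; exists 1. Qed.

Lemma rows_open0 : is_open rows_mms set0.
Proof. by []. Qed.

(** For [y] in [E], the whole space is an open superset of capacity at most [c * w y], while [E] has
    capacity at least [w y]. *)
Lemma rows_propC (c : RR) : 1 <= c -> (forall x, 0 < w x) ->
  (forall x y, w x <= c * w y) -> forall E, (outer_inf rows_lat E <= c%:E * capX rows_lat E)%E.
Proof.
move=> c1 wp wc E; have c0 : 0 < c by exact: lt_le_trans ltr01 c1.
have [->|/set0P[y Ey]] := eqVneq E set0.
  rewrite capX_set0 mule0; apply: ereal_inf_lbound; exists set0; last exact: capX_set0.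
  by split; first exact: rows_open0.
apply: (@le_trans _ _ (capX rows_lat setT)).
  by apply: ereal_inf_lbound; exists setT => //; split; first exact: rows_openT.
apply: (@le_trans _ _ (c * w y)%:E).
  by apply: rows_capX_le => [|x _]; [rewrite mulr_ge0// ltW|exact: wc].
by rewrite EFinM lee_pmul2l//; exact: rows_capX_ge.
Qed.

Lemma rows_limit_outer_inf_ge k (m : RR) : (forall n, m <= w (k, n.+1)) ->
  (m%:E <= outer_inf rows_lat [set (k, 0%N)])%E.
Proof.
move=> wm; apply: le_ereal_inf_tmp => _ [G [oG kG] <-].
have [N hN] := rows_open_limit oG (kG _ erefl).
by apply: le_trans (rows_capX_ge (hN N (leqnn _))); rewrite lee_fin.
Qed.

(** A set of capacity below [m] misses row [k] entirely, but the indicator of the limit jumps there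
    from 1 to 0. *)
Lemma rows_not_propG (k : nat) (m : RR) : 0 < m -> m <= w (k, 0%N) ->
  (forall n, m <= w (k, n.+1)) -> ~ propG rows_lat.
Proof.
move=> m0 wk0 wkn; pose u x : \bar RR := (x == (k, 0%N))%:R%:E.
have uN : in_N1X rows_lat u.
  apply: (@rows_in_N1X_bounded _ (w (k, 0%N))) => x; rewrite /u.
  by case: eqVneq => [->|_]; rewrite ?abse1 ?mule1// abse0 mule0 lee_fin.
move=> /(_ u uN m m0)[E [capE [_ cE]]].
have nE n : ~ E (k, n).
  move=> /rows_capX_ge/le_lt_trans/(_ capE); rewrite lte_fin ltNge.
  by case: n => [|n]; rewrite ?wk0 ?wkn.
have [r [r0 rE]] := cE _ (nE 0%N) 1 ltr01.
have [N hN] := rows_dist_limit_lt k r0.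
have := rE _ (nE N.+1) (hN N (leqnn _)); rewrite /u !xpair_eqE/= eqxx/= sub0r.
by rewrite normrN normr1 ltxx.
Qed.

Lemma rows_cont_isolated u E k n : forall eps : RR, 0 < eps -> exists delta : RR,
  0 < delta /\ forall y, ~ E y -> rows_dist (k, n.+1) y < delta ->
    `|fine (u y) - fine (u (k, n.+1))| < eps.
Proof.
move=> e e0; have [r r0 rH] := rows_isolated k n.
by exists r; split=> // y _ /rH ->; rewrite subrr normr0.
Qed.

(** The limit has capacity 0, while its open neighbourhoods contain isolated points and so have
    capacity at least [m]. *)
Lemma rows_not_propE (k : nat) (m : RR) : 0 < m -> w (k, 0%N) = 0 ->
  (forall n, m <= w (k, n.+1)) -> ~ propE rows_lat.
Proof.
move=> m0 wk wm hE.
have c0 : capX rows_lat [set (k, 0%N)] = 0%E.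
  apply/eqP; rewrite eq_le capX_ge0 andbT.
  by apply: rows_capX_le => // _ ->; rewrite wk.
have [G [oG [kG cG]]] := hE _ c0 m m0.
have [N hN] := rows_open_limit oG (kG _ erefl).
have := le_lt_trans (rows_capX_ge (hN N (leqnn _))) cG.
by rewrite lte_fin ltNge wm.
Qed.

End WeightedRows.

(** * The separating examples *)

Lemma propA_propG (T : Type) (S : mms T) (X : qbfl S) : propA X -> propG X.
Proof. by move=> /propA_propF/propF_propG. Qed.

Lemma exists_propB_not_propG : exists (T : Type) (S : mms T) (X : qbfl S),
  banach X /\ propB X /\ ~ propG X.
Proof.
pose w (x : nat * nat) : RR := 1.
exists _, _, (@rows_lat w (fun=> ler01) (fun _ _ => ltr01)); split=> //; split.
  move=> E; rewrite -[leRHS]mul1e; apply: rows_propC => //= x y.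
  by rewrite mulr1.
by apply: (@rows_not_propG _ _ _ 0%N 1).
Qed.

(** Weights vary by a factor of at most 2, whence (C); a limit has capacity 1, its open
    neighbourhoods at least 2. *)
Lemma exists_propC_not_propB : exists (T : Type) (S : mms T) (X : qbfl S),
  banach X /\ propC X /\ ~ propB X.
Proof.
pose w (x : nat * nat) : RR := if x.2 is 0 then 1 else 2.
have w_gt0 x : 0 < w x by rewrite /w; case: x.2.
exists _, _, (@rows_lat w (fun x => ltW (w_gt0 x)) (fun k n => w_gt0 (k, n.+1))).
split=> //; split.
  exists 2; split; first lra.
  apply: rows_propC => //; first lra.
  by move=> x y; rewrite /w; case: x.2; case: y.2 => *; lra.
set X := rows_lat _ _ => hB.
have : (2%:E <= capX X [set (0%N, 0%N)])%E.
  by apply: le_trans (hB _); apply: rows_limit_outer_inf_ge.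
rewrite leNgt => /negP; apply.
apply: (@le_lt_trans _ _ 1%E); last by rewrite lte_fin; lra.
by apply: rows_capX_le => // _ ->.
Qed.

(** A set of capacity below [1/(k+1)] misses row [k], so a weakly quasicontinuous function is
    continuous everywhere. Against (C), the limit of row [k] has capacity at most [1/(k+1)] and its
    open neighbourhoods at least 1. *)
Lemma exists_propD_not_propC : exists (T : Type) (S : mms T) (X : qbfl S),
  banach X /\ propD X /\ ~ propC X.
Proof.
pose w (x : nat * nat) : RR := if x.2 is 0 then x.1.+1%:R^-1 else 1.
have w_gt0 x : 0 < w x by rewrite /w; case: x.2 => //; rewrite invr_gt0.
exists _, _, (@rows_lat w (fun x => ltW (w_gt0 x)) (fun k n => w_gt0 (k, n.+1))).
set X := rows_lat _ _; split=> //; split.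
  move=> u wu e e0; exists set0; split=> //; split; first by rewrite capX_set0.
  have H k : exists E, (forall n, ~ E (k, n)) /\
      cont_off (@rows_mms w (fun k n => w_gt0 (k, n.+1))) u E.
    have [|E [capE cE]] := wu (k.+1%:R^-1); first by rewrite invr_gt0.
    exists E; split=> // n /rows_capX_ge/le_lt_trans/(_ capE).
    rewrite lte_fin ltNge /w /=; case: n => [|n]; first by rewrite lexx.
    by rewrite invf_le1 ?ler1n.
  split=> [[k n] _|[k n] _ d d0].
    by have [E [nE [finE _]]] := H k; exact: finE.
  have [E [nE [_ cE]]] := H k; have [r [r0 rH]] := cE _ (nE n) d d0.
  exists (Num.min r 1); split; first by rewrite lt_min r0 ltr01.
  move=> [j m] _; rewrite lt_min => /andP[yr /rows_dist_row/= kj].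
  by apply: rH => //; rewrite -kj.
move=> [c [c1 hc]]; have c0 : 0 < c by exact: lt_le_trans ltr01 c1.
(* So that [k + 1 > c]. *)
pose k := Num.truncn c.
have : (1%:E <= c%:E * capX X [set (k, 0%N)])%E.
  by apply: le_trans (hc _); apply: rows_limit_outer_inf_ge.
rewrite leNgt => /negP; apply.
apply: (@le_lt_trans _ _ (c * k.+1%:R^-1)%:E).
  rewrite EFinM lee_pmul2l//.
  by apply: rows_capX_le => [|_ ->]; rewrite ?invr_ge0.
by rewrite lte_fin ltr_pdivrMr// mul1r truncnS_gt.
Qed.

(** The limits together have capacity 0 and all other points are isolated, whence (G). Against (F),
    the parity of [n] has no limit along a row, and changes on null sets cannot reach the isolated
    points. *)
Lemma exists_propG_not_propF : exists (T : Type) (S : mms T) (X : qbfl S),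
  banach X /\ propG X /\ ~ propF X.
Proof.
pose w (x : nat * nat) : RR := if x.2 is 0 then 0 else 1.
have w_ge0 x : 0 <= w x by rewrite /w; case: x.2.
exists _, _, (@rows_lat w w_ge0 (fun k n => ltr01)).
set X := rows_lat _ _; split=> //; split.
  move=> u /rows_in_N1X fu e e0; exists [set x | x.2 = 0%N]; split.
    apply: (@le_lt_trans _ _ 0%E); last by rewrite lte_fin.
    by apply: rows_capX_le => // x /= x0; rewrite /w x0.
  split=> -[k [|n]] => [/(_ erefl)//|_|/(_ erefl)//|_]; last exact: rows_cont_isolated.
  by apply: (rows_norm_fin w_ge0 fu); rewrite /w oner_eq0.
move=> hF; pose u (x : nat * nat) : \bar RR := (odd x.2)%:R%:E.
have [|v [qv [N [N0 vu]]]] := hF u.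
  apply: (@rows_in_N1X_bounded _ _ _ u 1) => x; rewrite /u /w.
  by case: odd; case: x.2 => *; rewrite ?abse0 ?abse1 ?mule0 ?mul1e ?mul0e ?lee_fin.
have [E [oE [capE [_ cE]]]] := qv 1 ltr01.
have nE1 k n : ~ E (k, n.+1).
  by move=> /rows_capX_ge/le_lt_trans/(_ capE); rewrite ltxx.
have nE k n : ~ E (k, n).
  case: n => [|n]; last exact: nE1.
  (* An open set containing a limit contains isolated points, which are already excluded. *)
  move=> /(rows_open_limit oE)[M hM]; exact: (nE1 k M (hM M (leqnn _))).
have nN n : ~ N (0%N, n.+1).
  move=> Nn; have : ((w (0%N, n.+1))%:E <= capX X N)%E by exact: rows_capX_ge.
  by rewrite N0 lee_fin ler10.
have h0 : 0 < 1 / 2 :> RR by lra.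
have [r [r0 rH]] := cE _ (nE 0%N 0%N) (1 / 2) h0.
have [M hM] := rows_dist_limit_lt 0 r0.
have := rH _ (nE 0%N M.+1) (hM M (leqnn _)).
have := rH _ (nE 0%N M.+2) (hM M.+1 (leqnSn _)).
rewrite (vu _ (nN M)) (vu _ (nN M.+1)) /u /=; move: (fine (v _)) => a.
by case: (odd M) {N0 capE} => /=; rewrite !ltr_norml => /andP[? ?] /andP[? ?]; lra.
Qed.

(** Finite norm bounds [n |u(k, n)|], so [u] tends to 0 along each row; the value 0 at the limits, a
    null set, makes it continuous. *)
Lemma exists_propF_not_propE : exists (T : Type) (S : mms T) (X : qbfl S),
  banach X /\ propF X /\ ~ propE X.
Proof.
pose w (x : nat * nat) : RR := x.2%:R.
have w_gt0 k n : 0 < w (k, n.+1) by rewrite ltr0n.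
exists _, _, (@rows_lat w (fun x => ler0n _ _) w_gt0).
set X := rows_lat _ _; split=> //; split; last first.
  by apply: (@rows_not_propE _ _ _ 0%N 1) => // n; rewrite ler1n.
move=> u /rows_in_N1X fu.
pose v (x : nat * nat) : \bar RR := if x.2 is 0 then 0%E else u x.
exists v; split; last first.
  exists [set x | x.2 = 0%N]; split; last by move=> [k [|n]] // /(_ erefl).
  apply/eqP; rewrite eq_le capX_ge0 andbT.
  by apply: rows_capX_le => // x /= x0; rewrite /w x0.
have fink k n : u (k, n.+1) \is a fin_num by apply: (rows_norm_fin _ fu) => //; rewrite gt_eqF.
move=> e e0; exists set0; split=> //; split; first by rewrite capX_set0.
split=> [[k [|n]] // _|[k [|n]] _ d d0]; [exact: fink| |exact: rows_cont_isolated].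
(* The added 1 makes [M] positive, hence a valid divisor. *)
pose M := fine (rows_norm w u) + 1.
have finM : rows_norm w u \is a fin_num by rewrite ge0_fin_numE// rows_norm_ge0.
have M0 : 0 < M by rewrite ltr_wpDl// fine_ge0// rows_norm_ge0.
exists (Num.min 1 (d / M)); split; first by rewrite lt_min ltr01 divr_gt0.
move=> [j [|n]] _; first by rewrite /v subrr normr0.
rewrite lt_min => /andP[/rows_dist_row/= <-].
rewrite rows_dist_limit ltr_pdivlMr// => lt.
rewrite /v /= subr0; apply: le_lt_trans lt.
rewrite ler_pdivlMl ?ltr0n//.
have := rows_norm_ub w u (k, n.+1).
rewrite -(fineK (fink k n)) -{1}(fineK finM) -EFinM lee_fin /w /= => h.
by apply: le_trans h _; rewrite /M lerDl.
Qed.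

(** Row 0 refutes (E) and row 1 refutes (G); the general implications carry these failures to the
    other properties. *)
Lemma exists_all_fail : exists (T : Type) (S : mms T) (X : qbfl S),
  ~ propA X /\ ~ propB X /\ ~ propC X /\ ~ propD X /\
  ~ propE X /\ ~ propF X /\ ~ propG X.
Proof.
pose w (x : nat * nat) : RR := (x != (0%N, 0%N))%:R.
have w_gt0 k n : 0 < w (k, n.+1) by rewrite /w xpair_eqE andbF.
exists _, _, (@rows_lat w (fun x => ler0n _ _) w_gt0).
set X := rows_lat _ _.
have nE : ~ propE X by apply: (@rows_not_propE _ _ _ 0%N 1).
have nG : ~ propG X by apply: (@rows_not_propG _ _ _ 1%N 1).
have AG := @propA_propG _ _ X; have FG := @propF_propG _ _ X.
have BC := @propB_propC _ _ X; have CD := @propC_propD _ _ X.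
have DE := @propD_propE _ _ X.
by tauto.
Qed.

Theorem theorem1p2 :
  (forall (T : Type) (S : mms T) (X : qbfl S),
     ((propD X /\ propG X) <-> (propE X /\ propF X)) /\
     ((propE X /\ propF X) <-> propA X) /\
     (propA X -> propB X) /\ (propB X -> propC X) /\
     (propC X -> propD X) /\ (propD X -> propE X) /\
     (propA X -> propF X) /\ (propF X -> propG X)) /\
  (exists (T : Type) (S : mms T) (X : qbfl S), banach X /\ propB X /\ ~ propA X) /\
  (exists (T : Type) (S : mms T) (X : qbfl S), banach X /\ propC X /\ ~ propB X) /\
  (exists (T : Type) (S : mms T) (X : qbfl S), banach X /\ propD X /\ ~ propC X) /\
  (exists (T : Type) (S : mms T) (X : qbfl S), banach X /\ propB X /\ ~ propG X) /\
  (exists (T : Type) (S : mms T) (X : qbfl S), banach X /\ propG X /\ ~ propF X) /\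
  (exists (T : Type) (S : mms T) (X : qbfl S), banach X /\ propF X /\ ~ propE X) /\
  (exists (T : Type) (S : mms T) (X : qbfl S),
     ~ propA X /\ ~ propB X /\ ~ propC X /\ ~ propD X /\
     ~ propE X /\ ~ propF X /\ ~ propG X).
Proof.
split; first exact: property_implications.
split.
  (* Since (A) implies (G), the example against (B) implying (G) also separates (B) from (A). *)
  have [T [S [X [bX [hB nG]]]]] := exists_propB_not_propG.
  by exists T, S, X; split=> //; split=> // /propA_propG.
split; first exact: exists_propC_not_propB.
split; first exact: exists_propD_not_propC.
split; first exact: exists_propB_not_propG.
split; first exact: exists_propG_not_propF.
split; [exact: exists_propF_not_propE|exact: exists_all_fail].
Qed.
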